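(* Let $A$ be an alternative Cartan $*$-algebra with $\mathbb{S}_A\ne\varnothing$, let $\Omega\subset Q_A$ be an open circular set and let $f:\Omega\to A$ be a slice function. Let $K\in\mathcal{P}(n)$ be such that $e_K\in\mathbb{S}_A$, let $m\in K$, and set $\Omega_{e_K}:=\Omega\cap\mathbb{C}_{e_K}$. If $f$ is slice regular, then for each $M\in\mathcal{P}(n)$ such that $m\notin M$ there exists a holomorphic function $\varphi_M:\Omega_{e_K}\to\mathbb{C}_{e_K}$ such that $$f(x)=\sum_{M\in\mathcal{P}(n),\,m\notin M}\varphi_M(x)\,e_{M\triangle K}$$ for each $x\in\Omega_{e_K}$.
   Context: **Cartan $*$-algebras.** Let $n\ge 1$, let $\mathcal{P}(n)$ be the power set of $\{1,\dots,n\}$ and $K\triangle H:=(K\setminus H)\cup(H\setminus K)$. A Cartan algebra is a real (not necessarily associative) algebra $A$ with a fixed real vector basis $\{e_K\}_{K\in\mathcal{P}(n)}$ and a function $\sigma:\mathcal{P}(n)\times\mathcal{P}(n)\to\{-1,1\}$ such that $\sigma(K,\varnothing)=\sigma(\varnothing,K)=1$ and $e_Ke_H=\sigma(K,H)e_{K\triangle H}$ for all $K,H$. Thus $e_\varnothing=1$ is the unity, and $\mathbb{R}$ is identified with $\mathbb{R}1\subset A$. $A$ is alternative if $x(xy)=x^2y$ and $(xy)y=xy^2$ for all $x,y$. A $*$-involution is a real linear map $x\mapsto x^c$ with $(x^c)^c=x$, $(xy)^c=y^cx^c$ and $x^c=x$ for $x\in\mathbb{R}$. A Cartan $*$-algebra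 is a Cartan algebra endowed with a $*$-involution such that $e_{\{k\}}^c\in\{e_{\{k\}},-e_{\{k\}}\}$ for $k=1,\dots,n$. Set $\mathbb{S}_A:=\{J\in A: J^c=-J,\ J^2=-1\}$. The paper assumes throughout that $A$ is alternative and $\mathbb{S}_A\neq\varnothing$. **Slice regular functions.** For $J\in\mathbb{S}_A$ let $\mathbb{C}_J:=\{\alpha+\beta J:\alpha,\beta\in\mathbb{R}\}$, which is identified with $\mathbb{C}$ via $\alpha+i\beta\mapsto\alpha+\beta J$ (holomorphy of functions from subsets of $\mathbb{C}_J$ to $\mathbb{C}_J$ is meant through this identification), and let $Q_A:=\bigcup_{J\in\mathbb{S}_A}\mathbb{C}_J$. For $D\subset\mathbb{C}$ non-empty, open and invariant under complex conjugation, let $\Omega_D:=\{\alpha+\beta J:\alpha,\beta\in\mathbb{R},\ \alpha+i\beta\in D,\ J\in\mathbb{S}_A\}\subset Q_A$ (an open circular set). A stem function on $D$ is $F=F_1+\iota F_2:D\to A\otimes_{\mathbb{R}}\mathbb{C}$ ($\iota$ the imaginary unit of the second factor, $F_1,F_2:D\to A$) with $F_1(\bar z)=F_1(z)$, $F_2(\bar z)=-F_2(z)$. It induces the slice function $f=\mathcal{I}(F):\Omega_D\to A$, $f(\alpha+\beta J)=F_1(\alpha+i\beta)+JF_2(\alpha+i\beta)$. $f$ is slice regular if $F$ is of class $C^1$ and $\frac{\partial F}{\partial\alpha}+\iota\frac{\partial F}{\partial\beta}=0$. *)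

(* Defs.v *)
From mathcomp Require Import all_boot all_order all_algebra.
From mathcomp Require Import boolp classical_sets reals topology normedtype derive.
From mathcomp Require Import complex sesquilinear.

Set Implicit Arguments.
Unset Strict Implicit.
Unset Printing Implicit Defensive.

Import Order.TTheory GRing.Theory Num.Theory numFieldNormedType.Exports.

Local Open Scope classical_set_scope.
Local Open Scope ring_scope.
Local Open Scope complex_scope.

Definition symdiff (T : finType) (K H : {set T}) : {set T} :=
  (K :\: H) :|: (H :\: K).

(* The index set {1, ..., n} is encoded as 'I_n. *)
Record cartanAlgebra (R : realType) (n : nat) := CartanAlgebra {
  cartan_sort :> vectType R;
  cmul : {bilinear cartan_sort -> cartan_sort -> cartan_sort};
  cbase : {set 'I_n} -> cartan_sort;
  csigma : {set 'I_n} -> {set 'I_n} -> R;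
  cbase_basis : basis_of fullv (codom_tuple cbase);
  csigma_sign : forall K H, csigma K H = 1 \/ csigma K H = -1;
  csigma0 : forall K, csigma K finset.set0 = 1 /\ csigma finset.set0 K = 1;
  cmul_base : forall K H,
    cmul (cbase K) (cbase H) = csigma K H *: cbase (symdiff K H)
}.

Definition cone (R : realType) (n : nat) (A : cartanAlgebra R n) : A :=
  cbase A finset.set0.

Record cartanStarAlgebra (R : realType) (n : nat) := CartanStarAlgebra {
  star_cartan :> cartanAlgebra R n;
  cconj : {linear star_cartan -> star_cartan};
  cconjK : forall x, cconj (cconj x) = x;
  cconjM : forall x y, cconj (cmul _ x y) = cmul _ (cconj y) (cconj x);
  cconj_real : forall a : R, cconj (a *: cone star_cartan) = a *: cone star_cartan;
  cconj_base1 : forall k : 'I_n,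
    cconj (cbase _ [set k]%SET) = cbase _ [set k]%SET \/
    cconj (cbase _ [set k]%SET) = - cbase _ [set k]%SET
}.

Definition alternative (R : realType) (n : nat) (A : cartanAlgebra R n) : Prop :=
  forall x y : A,
    cmul A x (cmul A x y) = cmul A (cmul A x x) y /\
    cmul A (cmul A x y) y = cmul A x (cmul A y y).

Definition coordinate (R : realType) (n : nat) (A : cartanAlgebra R n)
    (K : {set 'I_n}) (x : A) : R :=
  coord (codom_tuple (cbase A)) (enum_rank K) x.

Section Slice.
Variables (R : realType) (n : nat) (A : cartanStarAlgebra R n).

Definition imag_units : set A :=
  [set J | cconj A J = - J /\ cmul A J J = - cone A].

(* The identification of C with C_J. *)
Definition slice_emb (J : A) (z : R[i]) : A :=
  complex.Re z *: cone A + complex.Im z *: J.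

Definition slice_plane (J : A) : set A := range (slice_emb J).

(* R[i]^o is the complex field with its usual norm topology. *)
Definition circular_base (D : set R[i]^o) : Prop :=
  [/\ D !=set0, open D & forall z, D z -> D (z^*)].

Definition circular (D : set R[i]^o) : set A :=
  [set x | exists z J, [/\ D z, imag_units J & x = slice_emb J z]].

(* Elements of the complexified algebra are written x + iota y and encoded as
   the pair (x, y); iota is the imaginary unit of the second tensor factor. *)
Definition iota_mul (w : A * A) : A * A := (- w.2, w.1).

(* Functions on D, and on circular D, are given by total functions of which
   only the values on D, resp. on circular D, matter. *)
Definition stem (D : set R[i]^o) (F : R[i] -> A * A) : Prop :=
  forall z, D z -> (F (z^*)).1 = (F z).1 /\ (F (z^*)).2 = - (F z).2.

Definition induces (D : set R[i]^o) (F : R[i] -> A * A) (f : A -> A) : Prop :=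
  forall z J, D z -> imag_units J ->
    f (slice_emb J z) = (F z).1 + cmul A J (F z).2.

Definition slice_function (D : set R[i]^o) (f : A -> A) : Prop :=
  exists F, stem D F /\ induces D F f.

Definition horizontal (g : R[i] -> R) (z : R[i]) : R -> R :=
  fun t => g (t +i* complex.Im z).

Definition vertical (g : R[i] -> R) (z : R[i]) : R -> R :=
  fun t => g (complex.Re z +i* t).

Definition d_alpha (g : R[i] -> R) (z : R[i]) : R :=
  derive1 (horizontal g z) (complex.Re z).

Definition d_beta (g : R[i] -> R) (z : R[i]) : R :=
  derive1 (vertical g z) (complex.Im z).

Definition class_C1 (D : set R[i]^o) (g : R[i] -> R) : Prop :=
  forall z, D z ->
    [/\ derivable (horizontal g z) (complex.Re z) 1,
        derivable (vertical g z) (complex.Im z) 1,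
        {for z, continuous (d_alpha g : R[i]^o -> R)} &
        {for z, continuous (d_beta g : R[i]^o -> R)}].

(* The algebra is a finite-dimensional real vector space, so differentiation of
   functions valued in it is done on the coordinates in the fixed basis. *)
Definition stem_C1 (D : set R[i]^o) (F : R[i] -> A * A) : Prop :=
  forall K, class_C1 D (fun z => coordinate K (F z).1) /\
            class_C1 D (fun z => coordinate K (F z).2).

Definition stem_partial (d : (R[i] -> R) -> R[i] -> R) (F : R[i] -> A * A)
    (z : R[i]) : A * A :=
  (\sum_(K : {set 'I_n}) d (fun w => coordinate K (F w).1) z *: cbase A K,
   \sum_(K : {set 'I_n}) d (fun w => coordinate K (F w).2) z *: cbase A K).

(* The stem function inducing f is determined by f on D, so that the
   existential does not depend on a choice. *)
Definition slice_regular (D : set R[i]^o) (f : A -> A) : Prop :=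
  exists F, [/\ stem D F, induces D F f, stem_C1 D F &
    forall z, D z ->
      stem_partial d_alpha F z + iota_mul (stem_partial d_beta F z) = 0].

(* phi maps U, a subset of C_J, into C_J and corresponds under the
   identification of C with C_J to a complex differentiable function h. *)
Definition slice_holomorphic (J : A) (U : set A) (phi : A -> A) : Prop :=
  (forall x, U x -> slice_plane J (phi x)) /\
  exists h : R[i]^o -> R[i]^o, forall z, U (slice_emb J z) ->
    phi (slice_emb J z) = slice_emb J (h z) /\ derivable h z 1.

End Slice.

Arguments imag_units {R n} A _ : rename.
Arguments circular {R n} A D _ : rename.

(* Main.v *)
Require Import Defs.
From mathcomp Require Import all_boot all_order all_algebra.
From mathcomp Require Import boolp classical_sets reals topology normedtype derive.
From mathcomp Require Import complex sesquilinear.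
From mathcomp Require Import ring lra.

Import Order.TTheory GRing.Theory Num.Theory numFieldNormedType.Exports.

Local Open Scope classical_set_scope.
Local Open Scope ring_scope.

(** Write J = e_K.  A stem function F = F_1 + iota F_2 splits along the basis
    into complex-valued components c_H = F_{1,H} + i F_{2,H}, one for each
    index set H.  Slice regularity says exactly that F is C^1 and satisfies
    the Cauchy-Riemann system, and that system splits too: every c_H is C^1 and
    satisfies the classical Cauchy-Riemann equations, hence is holomorphic
    (stem_component_derivable, from the real-variable criterion
    cauchy_riemann_derivable).

    On the slice C_J the induced function is therefore
    f(x) = \sum_H c_H(x) e_H, with c_H(x) read in C_J
    (stem_value_expansion).  Since m is in K, the map H |-> H \triangle K
    exchanges the index sets containing m with those avoiding it, so the sum
    groups into pairs {M, M \triangle K} with m not in M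
    (big_symdiff_split).  In such a pair e_M = s J e_{M \triangle K} with a
    sign s, and alternativity makes A a left vector space over C_J
    (cmul_slice_embM); so e_M can be absorbed into e_{M \triangle K} by
    multiplying its coefficient by the constant s J.  This gives
    \varphi_M = c_{M \triangle K} + i s c_M, which is holomorphic as a complex
    linear combination of holomorphic functions. *)

(** * The Cauchy-Riemann criterion for C^1 functions *)

Section ComplexDerivative.
Set Implicit Arguments.
Unset Strict Implicit.
Local Open Scope complex_scope.
Variable R : realType.
Implicit Types (D : set R[i]^o) (g u v : R[i] -> R) (z w : R[i]).

(** Mean value inequality for f - l id.  The hypothesis is on the closed ball of
    radius |s|, so that the sign of s does not matter to the users. *)
Lemma increment_bound (f : R -> R) (l e a s : R) :
  (forall t, `|t - a| <= `|s| -> derivable f t 1 /\ `|derive1 f t - l| <= e) ->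
  `|f (a + s) - f a - l * s| <= e * `|s|.
Proof.
move=> fP.
have der t : `|t - a| <= `|s| -> is_derive t 1 f (derive1 f t).
  by move=> /fP[df _]; apply: DeriveDef => //; rewrite derive1E.
have cont b c : {in `[b, c], forall t, `|t - a| <= `|s|} ->
    {within `[b, c], continuous f}.
  by move=> sub; apply: derivable_within_continuous => t /sub/fP[].
have [s_ge0|s_lt0] := leP 0 s.
  have sub : {in `[a, a + s], forall t, `|t - a| <= `|s|}.
    move=> t; rewrite in_itv/= => /andP[at_ ts].
    by rewrite (ger0_norm s_ge0) ger0_norm; lra.
  have le_as : a <= a + s by lra.
  have [|c cI fE] := MVT_segment (df := derive1 f) le_as _ (cont _ _ sub).
    by move=> t /subset_itv_oo_cc/sub/der.
  rewrite fE; have [_ ce] := fP c (sub c cI).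
  have -> : derive1 f c * (a + s - a) - l * s = (derive1 f c - l) * s by ring.
  by rewrite normrM ler_wpM2r.
have sub : {in `[a + s, a], forall t, `|t - a| <= `|s|}.
  move=> t; rewrite in_itv/= => /andP[at_ ts].
  by rewrite (ltr0_norm s_lt0) ler0_norm; lra.
have le_as : a + s <= a by lra.
have [|c cI fE] := MVT_segment (df := derive1 f) le_as _ (cont _ _ sub).
  by move=> t /subset_itv_oo_cc/sub/der.
have [_ ce] := fP c (sub c cI).
have -> : f (a + s) - f a - l * s = (derive1 f c - l) * s.
  rewrite -[f (a + s) - f a]opprB fE; ring.
by rewrite normrM ler_wpM2r.
Qed.

Lemma normc_le_Re_Im z : `|z| <= (`|complex.Re z| + `|complex.Im z|)%:C.
Proof.
rewrite normc_def lecR -[leRHS]ger0_norm ?addr_ge0// -sqrtr_sqr.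
rewrite ler_wsqrtr// sqrrD !real_normK ?num_real//.
by rewrite addrAC lerDl mulrn_wge0 // mulr_ge0.
Qed.

Lemma normc_ge_Im z : `|complex.Im z|%:C <= `|z|.
Proof. by rewrite normc_def lecR -sqrtr_sqr ler_wsqrtr// lerDr sqr_ge0. Qed.

(** Rectangles suit partial derivatives better than disks: from the centre each
    point of a rectangle is reached by a vertical and then a horizontal segment
    that both stay inside. *)
Lemma nbhs_box z (P : set R[i]^o) : nbhs (z : R[i]^o) P ->
  exists2 r : R, 0 < r & forall s t, `|s| < r -> `|t| < r ->
    P ((complex.Re z + s) +i* (complex.Im z + t)).
Proof.
move=> /nbhs_ballP[[r ri]]; rewrite /= ltcE /= => /andP[/eqP -> r_gt0] sub.
(* The Euclidean norm is at most |s| + |t|, hence the factor 2. *)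
exists (r / 2); first by lra.
move=> s t hs ht; apply: sub.
rewrite -ball_normE /ball_ /=.
have -> : z - ((complex.Re z + s) +i* (complex.Im z + t)) = (- s) +i* (- t).
  by case: z => a b /=; apply/eqP; rewrite eq_complex /= !opprD !addNKr ?addrA ?subrr ?add0r !eqxx.
apply: le_lt_trans (normc_le_Re_Im _) _.
by rewrite /= !normrN ltcR; lra.
Qed.

(** Continuous partial derivatives imply total differentiability.  The increment
    is cut into a vertical step from (a, b) to (a, b + t) and a horizontal one
    from (a, b + t) to (a + s, b + t); the mean value inequality bounds the error
    of each, the relevant partial derivative being within e of its value at z. *)
Lemma class_C1_increment D g z e : open D -> class_C1 D g -> D z -> 0 < e ->
  exists2 r : R, 0 < r & forall s t, `|s| < r -> `|t| < r ->
    `|g ((complex.Re z + s) +i* (complex.Im z + t)) - g z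
      - (d_alpha g z * s + d_beta g z * t)| <= e * (`|s| + `|t|).
Proof.
move=> oD gC1 Dz e_gt0; have [_ _ ca cb] := gC1 z Dz.
have nP : nbhs (z : R[i]^o) (fun w => [/\ D w, `|d_alpha g w - d_alpha g z| <= e &
    `|d_beta g w - d_beta g z| <= e]).
  have := ca; rewrite /continuous_at => /cvgrPdistC_le/(_ e e_gt0) na.
  have := cb; rewrite /continuous_at => /cvgrPdistC_le/(_ e e_gt0) nb.
  have nD : nbhs (z : R[i]^o) D by apply: open_nbhs_nbhs.
  exact: filterS3 nD na nb.
have [r r_gt0 box] := nbhs_box nP; exists r => // s t hs ht.
case: z => a b /= in Dz ca cb nP box *.
have incr_b := @increment_bound (vertical g (a +i* b)) (d_beta g (a +i* b)) e b t.
have incr_a := @increment_bound (horizontal g (a +i* (b + t))) (d_alpha g (a +i* b)) e a s.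
have {}incr_a : `|g ((a + s) +i* (b + t)) - g (a +i* (b + t)) -
    d_alpha g (a +i* b) * s| <= e * `|s|.
  apply: incr_a => x xs.
  have [Dx dx _] := box (x - a) t (le_lt_trans xs hs) ht.
  move: Dx dx; rewrite addrCA subrr addr0 => Dx dx.
  by have [dg _ _ _] := gC1 _ Dx; exact: conj dg dx.
have {}incr_b : `|g (a +i* (b + t)) - g (a +i* b) - d_beta g (a +i* b) * t| <= e * `|t|.
  apply: incr_b => x xs.
  have [|Dx _ dx] := box 0 (x - b) _ (le_lt_trans xs ht); first by rewrite normr0.
  move: Dx dx; rewrite addrCA subrr !addr0 => Dx dx.
  by have [_ dg _ _] := gC1 _ Dx; exact: conj dg dx.
rewrite mulrDr; apply: le_trans (lerD incr_a incr_b).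
apply: le_trans (ler_normD _ _); rewrite le_eqVlt; apply/orP; left; apply/eqP.
congr `|_|; ring.
Qed.

(** The Cauchy-Riemann equations say that the real differential of u + i v at z
    is multiplication by the complex number L = u_alpha + i v_alpha; the
    remainder of the first-order expansions is then also the remainder of the
    complex one. *)
Lemma cauchy_riemann_derivable D u v z : open D ->
  class_C1 D u -> class_C1 D v -> D z ->
  d_alpha u z = d_beta v z -> d_alpha v z = - d_beta u z ->
  derivable ((fun w => u w +i* v w) : R[i]^o -> R[i]^o) z 1.
Proof.
move=> oD uC1 vC1 Dz CR1 CR2.
set L := d_alpha u z +i* d_alpha v z.
rewrite /derivable; apply: (@cvgP _ _ (L : R[i]^o)).
apply/cvgrPdistC_le => e; rewrite ltcE /=.
(* Two remainders, each at most (e / 4) (|s| + |t|) with |s| and |t| bounded by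
   the norm of the increment: e / 4 adds up to e. *)
case: e => e ei /= /andP[/eqP -> e_gt0]; have e4 : 0 < e / 4 by lra.
have [r r_gt0 uP] := class_C1_increment oD uC1 Dz e4.
have [r' r'_gt0 vP] := class_C1_increment oD vC1 Dz e4.
have m_gt0 : 0 < (Num.min r r')%:C :> R[i] by rewrite ltcR lt_min r_gt0.
near=> w.
have w0 : w != 0 by near: w; exact: (@nbhs_dnbhs_neq R[i]^o 0).
have wm : `|w| < (Num.min r r')%:C.
  near: w; exact: (@dnbhs0_lt R[i] R[i]^o _ m_gt0).
set s := complex.Re w; set t := complex.Im w.
have /andP[sr sr'] : (`|s| < r) && (`|s| < r').
  by rewrite -lt_min -ltcR; apply: le_lt_trans wm; apply: normc_ge_Re.
have /andP[tr tr'] : (`|t| < r) && (`|t| < r').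
  rewrite -lt_min -ltcR; apply: le_lt_trans wm; apply: normc_ge_Im.
have {}uP := uP s t sr tr; have {}vP := vP s t sr' tr'.
set U := u (w + z) - u z - (d_alpha u z * s + d_beta u z * t).
set V := v (w + z) - v z - (d_alpha v z * s + d_beta v z * t).
have wzE : w + z = (complex.Re z + s) +i* (complex.Im z + t).
  by rewrite /s /t; case: (w) (z) => ? ? [? ?] /=; congr (_ +i* _); rewrite addrC.
have {uP}UE : `|U| <= e / 4 * (`|s| + `|t|) by rewrite /U wzE.
have {vP}VE : `|V| <= e / 4 * (`|s| + `|t|) by rewrite /V wzE.
have remE : (u (w + z) +i* v (w + z)) - (u z +i* v z) - w * L = U +i* V.
  rewrite /U /V /L -CR1 CR2 /s /t; case: (w) => x y.
  by apply/eqP; rewrite eq_complex /=; apply/andP; split; apply/eqP; ring.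
have -> : w^-1 *: ((((fun w => u w +i* v w) : R[i]^o -> R[i]^o) \o shift z) (w *: 1)
    - (u z +i* v z)) - L = w^-1 * (U +i* V).
  rewrite -remE mulrBr mulKf //=; congr (_ * (_ - _) - _).
  by rewrite [w *: 1]mulr1.
rewrite normrM normfV ler_pdivrMl ?normr_gt0//.
apply: le_trans (normc_le_Re_Im _) _.
have [n nE] : exists n : R, `|w| = n%:C by rewrite normc_def; eexists.
have sn : `|s| <= n by rewrite -lecR -nE; apply: normc_ge_Re.
have tn : `|t| <= n by rewrite -lecR -nE; apply: normc_ge_Im.
rewrite nE -rmorphM lecR /=; nra.
Unshelve. all: by end_near.
Qed.
End ComplexDerivative.

(** * Pairing index sets *)

Section CartanAlgebra.
Set Implicit Arguments.
Unset Strict Implicit.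
Local Open Scope complex_scope.
Variables (R : realType) (n : nat).

Lemma symdiffC (T : finType) (K H : {set T}) : symdiff K H = symdiff H K.
Proof. exact: finset.setUC. Qed.

Lemma in_symdiff (T : finType) (K H : {set T}) x :
  (x \in symdiff K H) = (x \in K) (+) (x \in H).
Proof. by rewrite !inE; case: (x \in K); case: (x \in H). Qed.

Lemma symdiffK (T : finType) (K : {set T}) : involutive (fun M => symdiff M K).
Proof. by move=> M; apply/setP => x; rewrite !in_symdiff addbK. Qed.

(** As m lies in K, the involution M |-> M \triangle K is a bijection from the sets
    avoiding m onto the sets containing m. *)
Lemma big_symdiff_split (V : nmodType) (T : finType) (K : {set T}) (m : T)
    (E : {set T} -> V) : m \in K ->
  \sum_H E H = \sum_(M : {set T} | m \notin M) (E M + E (symdiff M K)).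
Proof.
move=> mK; rewrite big_split /= (bigID (fun H : {set T} => m \notin H)) /=; congr (_ + _).
rewrite (reindex_inj (inv_inj (symdiffK K))) /=.
by apply: eq_bigl => M; rewrite in_symdiff mK addbT negbK.
Qed.

(** * Coordinates in the fixed basis *)

Section Coordinates.
Variable A : cartanAlgebra R n.

Lemma coordinate_expansion (x : A) : x = \sum_H coordinate H x *: cbase A H.
Proof.
rewrite {1}(coord_basis (cbase_basis A) (memvf x)).
rewrite (reindex _ (onW_bij _ (@enum_rank_bij {set 'I_n}))) /=.
by apply: eq_bigr => H _; rewrite nth_codom enum_rankK.
Qed.

Lemma cbase_free (a : {set 'I_n} -> R) :
  \sum_H a H *: cbase A H = 0 -> forall H, a H = 0.
Proof.
move=> a0 H; have /freeP freeA := basis_free (cbase_basis A).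
rewrite -(enum_rankK H); apply: (freeA (a \o enum_val)).
rewrite (reindex _ (onW_bij _ (@enum_rank_bij {set 'I_n}))) /= -[RHS]a0.
by apply: eq_bigr => L _; rewrite /= nth_codom enum_rankK.
Qed.

Lemma coordinate_sum (a : {set 'I_n} -> R) H :
  coordinate H (\sum_L a L *: cbase A L) = a H.
Proof.
apply/eqP; rewrite -subr_eq0; apply/eqP; move: H.
apply: cbase_free; under eq_bigr do rewrite scalerBl.
by rewrite sumrB -coordinate_expansion subrr.
Qed.

Lemma cmul1x (x : A) : cmul A (cone A) x = x.
Proof.
rewrite [x in LHS]coordinate_expansion linear_sumr [RHS]coordinate_expansion.
apply: eq_bigr => H _; rewrite linearZr_LR /cone cmul_base (csigma0 A H).2 scale1r.
by congr (_ *: cbase A _); apply/setP => i; rewrite in_symdiff inE.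
Qed.

Lemma cbase_neq0 H : cbase A H != 0.
Proof.
apply/eqP => H0; suff /(@cbase_free (fun L => (L == H)%:R))/(_ H)/eqP :
    \sum_L (L == H)%:R *: cbase A L = 0 by rewrite eqxx oner_eq0.
by apply: big1 => L _; case: eqVneq => [->|_]; rewrite ?H0 ?scaler0 ?scale0r.
Qed.

End Coordinates.

(** * The planes C_J *)

Variable A : cartanStarAlgebra R n.

Lemma cconj1 : cconj A (cone A) = cone A.
Proof. by have := cconj_real A 1; rewrite scale1r. Qed.

Lemma cmul_slice_emb (J x : A) (z : R[i]) :
  cmul A (slice_emb J z) x = complex.Re z *: x + complex.Im z *: cmul A J x.
Proof. by rewrite linearDl !linearZl_LR cmul1x. Qed.

Lemma slice_emb_conj (J : A) (z : R[i]) : imag_units A J ->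
  cconj A (slice_emb J z) = slice_emb J (z^*).
Proof.
case=> cJ _; rewrite linearD !linearZ /= cconj1 cJ /slice_emb.
by case: (z) => a b /=; rewrite scalerN scaleNr.
Qed.

(** Two planes C_J and C_J' meet only in points whose complex parameters agree up
    to conjugation: the involution isolates the real part, and the squares of
    b J and b' J' are -b^2 and -b'^2. *)
Lemma slice_emb_eq (J J' : A) (z z' : R[i]) : imag_units A J -> imag_units A J' ->
  slice_emb J z = slice_emb J' z' -> z = z' \/ z = z'^*.
Proof.
move=> uJ uJ' eqz; have := slice_emb_conj z uJ.
rewrite eqz slice_emb_conj //; case: uJ uJ' => _ JJ [_ JJ'].
case: z z' eqz => a b [a' b']; rewrite /slice_emb /= !scaleNr => eqz eqzc.
have n1 : cone A != 0 by apply: cbase_neq0.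
have aa' : a = a'.
  have /eqP : (a *+ 2 - a' *+ 2) *: cone A = 0.
    have /eqP : (a *: cone A + b *: J) + (a *: cone A - b *: J) =
      (a' *: cone A + b' *: J') + (a' *: cone A - b' *: J') by rewrite -eqzc eqz.
    rewrite (addrACA (a *: _)) (addrACA (a' *: _)) !subrr !addr0 -!scalerDl -!mulr2n.
    by rewrite -subr_eq0 -scalerBl => /eqP.
  by rewrite scaler_eq0 (negPf n1) orbF -mulrnBl mulrn_eq0 /= subr_eq0 => /eqP.
move: eqz; rewrite aa' => /addrI bJ.
have : cmul A (b *: J) (b *: J) = cmul A (b' *: J') (b' *: J') by rewrite bJ.
rewrite !linearZl_LR !linearZr_LR /= JJ JJ' !scalerA !scalerN => /oppr_inj/eqP.
rewrite -subr_eq0 -scalerBl scaler_eq0 (negPf n1) orbF subr_eq0 -!expr2 eqf_sqr.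
by case/orP=> /eqP ->; [left|right].
Qed.

(** A point of the circular set may come from another imaginary unit and the
    conjugate parameter; the symmetry of D makes this harmless. *)
Lemma circular_slice_emb (D : set R[i]^o) (J : A) (z : R[i]) : circular_base D ->
  imag_units A J -> circular A D (slice_emb J z) -> D z.
Proof.
move=> [_ _ Dc] uJ [z' [J' [Dz' uJ' /slice_emb_eq]]].
by case=> // ->; [exact: Dz' | exact: Dc].
Qed.

Lemma imag_unit_neq0 (J : A) : imag_units A J -> J != 0.
Proof.
case=> _ JJ; apply/eqP => J0; have /eqP := JJ.
by rewrite J0 linear0r eq_sym oppr_eq0 (negPf (cbase_neq0 _ _)).
Qed.

Lemma slice_emb_inj (J : A) : imag_units A J -> injective (slice_emb J).
Proof.
move=> uJ z z' eqz; have [//|zE] := slice_emb_eq uJ uJ eqz.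
have Im0 : complex.Im z' = 0.
  move: eqz; rewrite zE; case: (z') => a b /addrI/eqP.
  by rewrite -subr_eq0 -scalerBl scaler_eq0 (negPf (imag_unit_neq0 uJ)) orbF /=; lra.
by rewrite zE; case: (z') Im0 => a b /= ->; rewrite oppr0.
Qed.

Lemma slice_embD (J : A) (z w : R[i]) :
  slice_emb J (z + w) = slice_emb J z + slice_emb J w.
Proof. by case: z w => a b [c d]; rewrite /slice_emb !scalerDl addrACA. Qed.

(** Left multiplication makes A a left vector space over the field C_J, because
    J (J x) = (J J) x = - x in an alternative algebra. *)
Lemma cmul_slice_embM (J x : A) (z w : R[i]) : alternative A -> imag_units A J ->
  cmul A (slice_emb J z) (cmul A (slice_emb J w) x) =
  cmul A (slice_emb J (z * w)) x.
Proof.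
move=> A_alt [_ JJ]; have JJx : cmul A J (cmul A J x) = - x.
  by rewrite (A_alt J x).1 JJ linearNl cmul1x.
rewrite !cmul_slice_emb linearDr !linearZr_LR /= JJx; case: z w => a b [c d] /=.
rewrite !scalerDr !scalerA !scalerN scalerBl scalerDl -!addrA; congr (_ + _).
by rewrite addrA addrC.
Qed.

(** * Holomorphic components of a stem function *)

(** The coefficient of e_H in F, under the identification of A (x) C with the
    complex vector space of basis (e_H). *)
Definition stem_component (F : R[i] -> A * A) (H : {set 'I_n}) (z : R[i]) : R[i] :=
  coordinate H (F z).1 +i* coordinate H (F z).2.

(** The Cauchy-Riemann system of F is an equality in A x A; reading it on the H-th
    coordinate gives the classical equations for the H-th component. *)
Lemma stem_component_derivable (D : set R[i]^o) (F : R[i] -> A * A) H z :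
  open D -> stem_C1 D F ->
  (forall w, D w ->
    stem_partial (@d_alpha R) F w + iota_mul (stem_partial (@d_beta R) F w) = 0) ->
  D z -> derivable (stem_component F H : R[i]^o -> R[i]^o) z 1.
Proof.
move=> oD FC1 FCR Dz; have [C1 C2] := FC1 H.
have /(congr1 (fun p => (coordinate H p.1, coordinate H p.2))) := FCR z Dz.
rewrite /stem_partial /= -sumrB -big_split /=.
under eq_bigr do rewrite -scalerBl.
under [in X in (_, X) = _]eq_bigr do rewrite -scalerDl.
rewrite !coordinate_sum /coordinate linear0 => -[/eqP + /eqP].
rewrite subr_eq0 addr_eq0 => /eqP CR1 /eqP CR2.
exact: cauchy_riemann_derivable oD C1 C2 Dz CR1 CR2.
Qed.

Lemma stem_value_expansion (F : R[i] -> A * A) (J : A) (z : R[i]) :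
  (F z).1 + cmul A J (F z).2 =
  \sum_H cmul A (slice_emb J (stem_component F H z)) (cbase A H).
Proof.
under eq_bigr do rewrite cmul_slice_emb.
rewrite big_split /= -coordinate_expansion; congr (_ + _).
rewrite [(F z).2 in LHS]coordinate_expansion linear_sumr.
by apply: eq_bigr => H _; rewrite linearZr_LR.
Qed.

End CartanAlgebra.

(** * The splitting of a slice regular function *)

Theorem lemma5p21 (R : realType) (n : nat) (n_ge1 : (1 <= n)%N)
    (A : cartanStarAlgebra R n) (A_alt : alternative A)
    (S_neq0 : imag_units A !=set0)
    (D : set R[i]^o) (D_base : circular_base D)
    (f : A -> A) (f_slice : slice_function D f)
    (K : {set 'I_n}) (eK_unit : imag_units A (cbase A K))
    (m : 'I_n) (m_in_K : m \in K)
    (f_reg : slice_regular D f) :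
  let OmegaK := circular A D `&` slice_plane (cbase A K) in
  exists phi : {set 'I_n} -> A -> A,
    (forall M : {set 'I_n}, m \notin M ->
       slice_holomorphic (cbase A K) OmegaK (phi M)) /\
    (forall x : A, OmegaK x ->
       f x = \sum_(M : {set 'I_n} | m \notin M)
               cmul A (phi M x) (cbase A (symdiff M K))).
Proof.
move=> OmegaK; set J := cbase A K in eK_unit OmegaK *.
have [F [_ F_ind F_C1 F_CR]] := f_reg; have [_ D_open _] := D_base.
(* s M = i sigma(K, M \triangle K): on C_J it is the element carrying
   e_{M \triangle K} to e_M. *)
pose s M := Complex 0 (csigma A K (symdiff M K)).
pose h M z := stem_component F (symdiff M K) z + s M * stem_component F M z.
(* The total functions phi need a parameter z for every x; the default 0 is only
   taken off C_J. *)
pose emb_inv x := xget 0 [set z | slice_emb J z = x].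
have emb_invK z : emb_inv (slice_emb J z) = z.
  apply: (slice_emb_inj eK_unit).
  by apply: (@xgetPex _ 0 [set w | slice_emb J w = _]); exists z.
have OmegaK_D z : OmegaK (slice_emb J z) -> D z.
  by case=> Oz _; apply: circular_slice_emb Oz.
exists (fun M x => slice_emb J (h M (emb_inv x))); split.
  move=> M _; split=> [x _|]; first by exists (h M (emb_inv x)).
  exists (h M) => z /OmegaK_D Dz; rewrite emb_invK; split; first by [].
  have der H : derivable (stem_component F H : R[i]^o -> R[i]^o) z 1.
    exact: stem_component_derivable D_open F_C1 F_CR Dz.
  have derZ := @derivableZ _ _ _ _ (s M) _ _ (der M).
  have derD := derivableD (der (symdiff M K)) derZ.
  exact: derD.
move=> x Ox; have [_ [z _ zx]] := Ox; move: Ox; rewrite -zx => /OmegaK_D Dz.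
rewrite emb_invK (F_ind z J Dz eK_unit) stem_value_expansion.
rewrite (big_symdiff_split _ m_in_K); apply: eq_bigr => M _.
rewrite /h slice_embD [RHS]linearDl [LHS]addrC; congr (_ + _).
(* What remains is e_M = sigma J e_{M \triangle K}, which holds because
   J e_{M \triangle K} = sigma e_M and sigma is a sign. *)
rewrite mulrC -cmul_slice_embM //; congr (cmul A _ _).
rewrite cmul_slice_emb /= scale0r add0r cmul_base scalerA.
have -> : symdiff K (symdiff M K) = M by rewrite symdiffC symdiffK.
by case: (csigma_sign A K (symdiff M K)) => ->; rewrite ?mulrNN mulr1 scale1r.
Qed.
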